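(* Let $G=(V,E)$ be an unweighted, undirected, finite simple graph with $V=\{1,\dots,n\}$, and for $i\in V$ let $\deg_i=\#\{j\in V:\{j,i\}\in E\}$. Then: (1) The independence number of $G$ satisfies $$\alpha(G)=\max_{\vec x\in \mathbb{R}^n\setminus\{\vec 0\}}\frac{\sum_{\{i,j\}\in E}\big(|x_i-x_j|+|x_i+x_j|\big)-2\sum_{i\in V}(\deg_i-1)|x_i|}{2\|\vec x\|_\infty}.$$ (2) The chromatic number of $G$ satisfies $$\gamma(G)= n^2-\max_{\vec x\in\mathbb{R}^{n^2}\setminus\{\vec 0\}}\sum_{k\in V}\frac{n\sum_{\{i,j\}\in E}\big(|x_{ik}-x_{jk}|+|x_{ik}+x_{jk}|\big)+2n\|\vec x^{k}\|_{\infty}-2n\deg_k\|\vec x^{k}\|_1-2\|\vec x^{,k}\|_{\infty}}{2\|\vec x\|_\infty},$$ where $\vec x=(x_{ki})_{k,i\in V}\in\mathbb{R}^{n^2}$, $\vec x^{k}=(x_{k1},\dots,x_{kn})$ and $\vec x^{,k}=(x_{1k},\dots,x_{nk})^T$. (3) The maximum matching number of $G$ equals $$\max_{\vec y\in\mathbb{R}^E\setminus\{\vec 0\}}\frac{\|\vec y\|_1^2}{\|\vec y\|_1^2-2\sum_{e\cap e'=\varnothing}y_ey_{e'}},$$ where the sum runs over unordered pairs $\{e,e'\}$ of distinct edges with $e\cap e'=\varnothing$.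
   Context: The independence number $\alpha(G)$ is the largest cardinality of a set of pairwise non-adjacent vertices. The chromatic number $\gamma(G)$ is the smallest number of colors in a coloring of the vertices such that adjacent vertices get different colors. A matching is a set of pairwise disjoint edges; the maximum matching number is the largest cardinality of a matching. $\|\vec x\|_\infty=\max$ of absolute values of all entries, $\|\cdot\|_1$ is the sum of absolute values of entries. *)

(* Defs.v *)
From HB Require Import structures.
From mathcomp Require Import all_boot all_order all_algebra.
From mathcomp Require Import all_classical all_reals.
From mathcomp Require Import topology normedtype.
Set Implicit Arguments.
Unset Strict Implicit.
Unset Printing Implicit Defensive.
Import Order.TTheory GRing.Theory Num.Theory.
Local Open Scope ring_scope.

Record sgraph (n : nat) := SGraph {
  adj :> rel 'I_n;
  adj_sym : symmetric adj;
  adj_irrefl : irreflexive adj }.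

Section Graphs.
Variables (n : nat) (G : sgraph n).

Definition edges : {set {set 'I_n}} :=
  ([set [set p.1; p.2] | p : 'I_n * 'I_n & G p.1 p.2])%SET.

Definition deg (i : 'I_n) : nat := #|[set j | G j i]%SET|.

Definition independent (S : {set 'I_n}) : bool :=
  [forall i in S, forall j in S, ~~ G i j].

Definition independence_number : nat :=
  (\max_(S : {set 'I_n} | independent S) #|S|)%N.

Definition colorable (k : nat) : bool :=
  [exists f : {ffun 'I_n -> 'I_k},
    [forall i, forall j, G i j ==> (f i != f j)]].

Lemma ex_colorable : exists k, colorable k.
Proof.
exists n; apply/existsP; exists [ffun i => i].
apply/forallP => i; apply/forallP => j; apply/implyP => Gij.
by rewrite !ffunE; apply: contraTneq Gij => ->; rewrite adj_irrefl.
Qed.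

Definition chromatic_number : nat := ex_minn ex_colorable.

Definition matching (M : {set {set 'I_n}}) : bool :=
  (M \subset edges) && finset.trivIset M.

Definition matching_number : nat :=
  (\max_(M : {set {set 'I_n}} | matching M) #|M|)%N.

Definition edge : finType := {e : {set 'I_n} | e \in edges}.

(* Each edge {i, j} is counted once, through its representative with i < j;
   the summand is meant to be symmetric in (i, j). *)
Definition edge_sum (R : nmodType) (F : 'I_n -> 'I_n -> R) : R :=
  \sum_(i < n) \sum_(j < n | (i < j)%N && G i j) F i j.

(* Each unordered pair of distinct disjoint edges is counted once, via the
   enumeration order of the finite type of edges; the summand is meant to be
   symmetric. *)
Definition disjoint_edges_sum (R : nmodType) (F : edge -> edge -> R) : R :=
  \sum_(e : edge) \sum_(e' : edge |
    (enum_rank e < enum_rank e')%N && [disjoint val e & val e']) F e e'.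

End Graphs.

Definition l1norm (R : numDomainType) (I : finType) (v : I -> R) : R :=
  \sum_i `|v i|.

Local Open Scope classical_set_scope.

(* The maximum exists and is attained: stronger than m = sup A. *)
Definition is_max (R : realType) (A : set R) (m : R) : Prop :=
  A m /\ ubound A m.

(* Main.v *)
(* Since |a - b| + |a + b| = 2 (|a| + |b|) - 2 min(|a|, |b|), the degree terms
   cancel and the first two quotients, with |x| for the entrywise absolute
   value, become
     (sum_i |x|_i - sum_E min(|x|_i, |x|_j)) / max |x|   and
     (n sum rowmax - sum colmax - n sum_k sum_E min(|x|_ik, |x|_jk)) / max |x|.
   For the first, orienting each edge towards its larger end shows that the
   numerator is at most the weight of the (independent) set of sinks.  For the
   second, the row-wise argmax is a proper coloring unless the total defect
   sum min + sum (max |x| - rowmax) is already at least max |x|.  The third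
   statement is the Motzkin-Straus theorem for the disjointness graph on the
   edges, whose cliques are the matchings. *)
Require Import Defs.
From HB Require Import structures.
From mathcomp Require Import all_boot all_order all_algebra.
From mathcomp Require Import all_classical all_reals.
From mathcomp Require Import topology normedtype.
From mathcomp Require Import ring lra.
Import Order.TTheory GRing.Theory Num.Theory.
Set Implicit Arguments.
Unset Strict Implicit.
Unset Printing Implicit Defensive.
Local Open Scope classical_set_scope.
Local Open Scope ring_scope.

(** * Absolute values, attained maxima and orientations of a symmetric relation *)

Lemma norm_sub_add (R : realDomainType) (x y : R) :
  `|x - y| + `|x + y| = 2 * (`|x| + `|y|) - 2 * Num.min `|x| `|y|.
Proof.
wlog le_xy : x y / `|x| <= `|y|.
  move=> H; have /orP[] := le_total `|x| `|y|; first exact: H.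
  by move=> /H; rewrite distrC [y + x]addrC [`|y| + _]addrC minC.
rewrite minEle le_xy; case: (ger0P y) le_xy => [y0|y0]; rewrite ler_norml => /andP[];
  move=> xl xr.
  by rewrite (ler0_norm (x := x - y)) ?(ger0_norm (x := x + y)); lra.
by rewrite (ger0_norm (x := x - y)) ?(ler0_norm (x := x + y)); lra.
Qed.

Lemma is_max_image (R : realType) (T : Type) (D : set T) (f : T -> R) (m : R) :
  (forall x, D x -> f x <= m) -> (exists2 x, D x & m <= f x) ->
  is_max [set f x | x in D] m.
Proof.
move=> f_le [x Dx fx_ge]; split; last by move=> _ [y Dy <-]; exact: f_le.
by exists x => //; apply/eqP; rewrite eq_le f_le.
Qed.

(** [lt] picks exactly one order of each [D]-related pair; exchanging the summations of the [F y x]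
    half supplies the opposite order. *)
Lemma sum_orient (R : nmodType) (T : finType) (lt D : rel T) (F : T -> T -> R) :
  symmetric D -> (forall x y, D x y -> lt y x = ~~ lt x y) ->
  \sum_x \sum_(y | lt x y && D x y) (F x y + F y x)
    = \sum_x \sum_(y | D x y) F x y.
Proof.
move=> Dsym ltD.
under eq_bigr do rewrite big_split /=.
rewrite big_split /= [X in _ + X](exchange_big_dep xpredT) //= -big_split /=.
apply: eq_bigr => x _; rewrite [RHS](bigID (lt x)) /=; congr (_ + _).
  by apply: eq_bigl => y; rewrite andbC.
apply: eq_bigl => y; rewrite Dsym andbC.
by case Dxy: (D x y) => //=; rewrite ltD.
Qed.

(** * Sums over the edges of a graph *)

Section GraphSums.
Variables (R : realDomainType) (n : nat) (G : sgraph n).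
Implicit Types (F : 'I_n -> 'I_n -> R) (b : 'I_n -> R).

Lemma adj_ltn i j : G i j -> (j < i)%N = ~~ (i < j)%N.
Proof.
by case: ltngtP => // /val_inj ->; rewrite adj_irrefl.
Qed.

(** Weighted handshake identity: each edge contributes the weight of both its ends. *)
Lemma sum_deg b :
  \sum_i (deg G i)%:R * b i = edge_sum G (fun i j => b i + b j).
Proof.
rewrite /edge_sum (sum_orient (lt := fun i j : 'I_n => (i < j)%N) (fun i _ => b i) (adj_sym G));
  last exact: adj_ltn.
apply: eq_bigr => i _; rewrite sumr_const mulr_natl; congr (_ *+ _).
by rewrite /deg; apply: eq_card => j; rewrite !inE adj_sym.
Qed.

Lemma edge_sum_adj0 F :
  (forall i j, G i j -> F i j = 0) -> edge_sum G F = 0.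
Proof. by move=> F0; rewrite /edge_sum big1// => i _; rewrite big1// => j /andP[_ /F0]. Qed.

Lemma edge_sum_abs b :
  edge_sum G (fun i j => `|b i - b j| + `|b i + b j|) =
  2 * (\sum_i (deg G i)%:R * `|b i|)
  - 2 * edge_sum G (fun i j => Num.min `|b i| `|b j|).
Proof.
rewrite (sum_deg (fun i => `|b i|)) /edge_sum -mulrBr -sumrB mulr_sumr.
apply: eq_bigr => i _; rewrite -sumrB mulr_sumr; apply: eq_bigr => j _.
by rewrite norm_sub_add mulrBr.
Qed.

Lemma edge_sum_ge0 F : (forall i j, 0 <= F i j) -> 0 <= edge_sum G F.
Proof. by move=> F0; apply: sumr_ge0 => i _; apply: sumr_ge0. Qed.

(** Symmetry of [F] allows [u] and [v] in either order, as [edge_sum] keeps only the increasing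
    representative of an edge. *)
Lemma le_edge_sum F u v : (forall i j, 0 <= F i j) ->
  (forall i j, F i j = F j i) -> G u v -> F u v <= edge_sum G F.
Proof.
move=> F0 Fsym Guv; wlog uv : u v Guv / (u < v)%N.
  move=> H; case: (boolP (u < v)%N) => [|nuv]; first exact: H.
  by rewrite Fsym; apply: H; rewrite 1?adj_sym// (adj_ltn Guv).
rewrite /edge_sum (bigD1 u)//= (bigD1 v)/= ?uv ?Guv// -addrA lerDl addr_ge0//.
  exact: sumr_ge0.
by apply: sumr_ge0 => i _; apply: sumr_ge0.
Qed.

(** By symmetry of [Num.min], the index order and [lt] both give half of the sum over ordered
    adjacent pairs. Along [lt] the minimum sits at the tail of each edge. *)
Lemma edge_sum_min_lt (lt : rel 'I_n) b :
  (forall i j, G i j -> lt j i = ~~ lt i j) ->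
  (forall i j, G i j -> lt i j -> b i <= b j) ->
  edge_sum G (fun i j => Num.min (b i) (b j)) =
  \sum_i \sum_(j | lt i j && G i j) b i.
Proof.
move=> ltG ltb.
have two_inj : injective (fun x : R => x *+ 2) by exact: (@pmulrnI R 2 isT).
have dbl (l : rel 'I_n) : (forall i j, G i j -> l j i = ~~ l i j) ->
  (\sum_i \sum_(j | l i j && G i j) Num.min (b i) (b j)) *+ 2 =
  \sum_i \sum_(j | G i j) Num.min (b i) (b j).
  move=> lG; rewrite -(sum_orient (lt := l) _ (adj_sym G))//.
  rewrite -sumrMnl; apply: eq_bigr => i _; rewrite -sumrMnl.
  by apply: eq_bigr => j _; rewrite mulr2n [X in _ + X]minC.
apply: two_inj => /=; rewrite /edge_sum (dbl (fun i j : 'I_n => (i < j)%N) adj_ltn) -(dbl lt)//.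
congr (_ *+ _); apply: eq_bigr => i _; apply: eq_bigr => j /andP[lij Gij].
by rewrite minEle ltb.
Qed.

End GraphSums.

(** * Extracting an independent set from vertex weights *)

Lemma independent_weight (R : realDomainType) n (G : sgraph n) (b : 'I_n -> R) :
  (forall i, 0 <= b i) ->
  exists2 S, independent G S &
    \sum_i b i - edge_sum G (fun i j => Num.min (b i) (b j)) <= \sum_(i in S) b i.
Proof.
(* Ties are broken by index, so that every edge gets exactly one direction. *)
move=> b0; pose lt i j := (b i < b j) || (b i == b j) && (i < j)%N.
have ltG i j : G i j -> lt j i = ~~ lt i j.
  by move=> Gij; rewrite /lt; case: ltgtP => //= _; exact: adj_ltn Gij.
have ltb i j : G i j -> lt i j -> b i <= b j.
  by move=> _ /orP[/ltW//|/andP[/eqP->]].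
(* The vertices that beat all their neighbours; every other vertex is charged to an edge. *)
pose S := [set i | [forall j, G i j ==> ~~ lt i j]]%SET; exists S.
  apply/forallP => i; apply/implyP; rewrite inE => /forallP Si.
  apply/forallP => j; apply/implyP; rewrite inE => /forallP Sj.
  apply/negP => Gij; move: (Si j) (Sj i); rewrite Gij adj_sym Gij /=.
  by rewrite (ltG _ _ Gij) => ->.
(* The weights on [S] cancel. A vertex [i] outside [S] has an outgoing edge, whose term [b i] in the
   inner sum pays for it. *)
rewrite (edge_sum_min_lt ltG ltb) lerBlDr (bigID [in S])/=.
rewrite lerD2l big_mkcond/=; apply: ler_sum => i _.
case: ifP => [|_]; last by apply: sumr_ge0.
rewrite inE => /forallPn[j]; rewrite negb_imply negbK => /andP[Gij lij].
by rewrite (bigD1 j)/= ?lij ?Gij// lerDl sumr_ge0.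
Qed.

(** * The entrywise sup norm of a matrix *)

Section MxNorm.
Variables (R : realDomainType) (m n : nat) (x : 'M[R]_(m, n)).

Lemma le_mx_norm i j : `|x i j| <= mx_norm x.
Proof. by rewrite mx_normrE (le_bigmax _ (fun ij => `|x ij.1 ij.2|) (i, j)). Qed.

Lemma mx_norm_le c : 0 <= c -> (forall i j, `|x i j| <= c) -> mx_norm x <= c.
Proof. by move=> c0 xc; rewrite mx_normrE; apply: bigmax_le => // -[]. Qed.

Lemma mx_norm_ge0 : 0 <= mx_norm x.
Proof. by rewrite mx_normrE; apply: bigmax_ge_id. Qed.

Lemma mx_norm_gt0 : x != 0 -> 0 < mx_norm x.
Proof.
by rewrite lt0r mx_norm_ge0 andbT; apply: contra => /eqP /mx_norm_eq0 ->.
Qed.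

Lemma mx_norm_attained : (0 < m)%N -> (0 < n)%N ->
  exists i j, mx_norm x = `|x i j|.
Proof.
(* Norm zero means the zero matrix, where any entry serves; positive dimensions ensure that there is
   one. *)
move=> m0 n0; have [x0|/mx_norm_neq0[[i j] ->]] := eqVneq (mx_norm x) 0.
  exists (Ordinal m0), (Ordinal n0); rewrite (mx_norm_eq0 x0).
  by rewrite mxE normr0 mx_norm0.
by exists i, j.
Qed.

End MxNorm.

(** * The independence ratio *)

Lemma independence_ratio_max (R : realType) n (G : sgraph n) : (0 < n)%N ->
  is_max
    [set (edge_sum G (fun i j => `|x ord0 i - x ord0 j| + `|x ord0 i + x ord0 j|)
          - 2 * \sum_(i < n) ((deg G i)%:R - 1) * `|x ord0 i|)
         / (2 * mx_norm x)
    | x in [set x : 'rV[R]_n | x != 0]]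
    (independence_number G)%:R.
Proof.
move=> n0.
have numE (x : 'rV[R]_n) :
    edge_sum G (fun i j => `|x ord0 i - x ord0 j| + `|x ord0 i + x ord0 j|)
    - 2 * \sum_(i < n) ((deg G i)%:R - 1) * `|x ord0 i| =
    2 * (\sum_i `|x ord0 i|
         - edge_sum G (fun i j => Num.min `|x ord0 i| `|x ord0 j|)).
  rewrite (edge_sum_abs G (x ord0)).
  under [X in _ - 2 * X]eq_bigr do rewrite mulrBl mul1r.
  by rewrite sumrB; ring.
apply: is_max_image => [x /mx_norm_gt0 x0|].
  rewrite numE invfM mulrACA divff ?pnatr_eq0// mul1r ler_pdivrMr//.
  have [//|S indS] := @independent_weight R n G (fun i => `|x ord0 i|).
  move=> /le_trans; apply.
  apply: (@le_trans _ _ (#|S|%:R * mx_norm x)).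
    rewrite mulr_natl -sumr_const; apply: ler_sum => i _; exact: le_mx_norm.
  rewrite ler_wpM2r ?mx_norm_ge0// ler_nat.
  exact: (@leq_bigmax_cond _ (independent G) (fun S => #|S|)).
(* Singletons are independent, so a maximum independent set is nonempty and its indicator vector is
   nonzero. *)
have ind0 i : independent G [set i]%SET.
  apply/forallP => j; apply/implyP => /set1P ->.
  by apply/forallP => k; apply/implyP => /set1P ->; rewrite adj_irrefl.
have [|S indS Smax] := @eq_bigmax_cond _ [in independent G] (fun S => #|S|).
  by apply/card_gt0P; exists [set Ordinal n0]%SET; exact: ind0.
have S_gt0 : (0 < #|S|)%N.
  rewrite -Smax; apply: leq_trans (leq_bigmax_cond _ (ind0 (Ordinal n0))).
  by rewrite cards1.
have /card_gt0P[i0 i0S] := S_gt0.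
(* The indicator of a maximum independent set attains the bound: each edge has an end outside [S],
   so all minima vanish. *)
pose x : 'rV[R]_n := \row_i (i \in S)%:R.
have xE i : `|x ord0 i| = (i \in S)%:R by rewrite mxE normr_nat.
have x0 : x != 0.
  apply: contraTneq i0S => /(congr1 (fun y : 'rV_n => y ord0 i0))/eqP.
  by rewrite !mxE pnatr_eq0 eqb0.
exists x => //; rewrite numE invfM mulrACA divff ?pnatr_eq0// mul1r.
rewrite ler_pdivlMr ?mx_norm_gt0// edge_sum_adj0 ?subr0; last first.
  move=> i j Gij; rewrite !xE.
  move: indS => /forallP/(_ i)/implyP Si.
  case iS: (i \in S); last by rewrite min_l.
  have /forallP/(_ j) := Si iS; rewrite Gij implybF => /negbTE ->.
  by rewrite min_r.
under eq_bigr do rewrite xE.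
rewrite -natr_sum -(@big_mkcond _ _ _ _ _ [in S] (fun=> 1%N)) sum1_card.
rewrite /independence_number Smax.
rewrite -[leRHS]mulr1 ler_wpM2l// mx_norm_le// => i j; rewrite (ord1 i) xE.
by rewrite lern1 leq_b1.
Qed.

(** * Colorings and the chromatic ratio *)

Section Chromatic.
Variables (n : nat) (G : sgraph n).

(** Only the colors in use count: ranking them within the image of [f] yields a coloring by an
    ordinal type. *)
Lemma chromatic_number_le (T : finType) (f : 'I_n -> T) :
  (forall i j, G i j -> f i != f j) -> (chromatic_number G <= #|f @: 'I_n|)%N.
Proof.
move=> f_proper; rewrite /chromatic_number; case: ex_minnP => k _; apply.
have fP i : f i \in (f @: 'I_n)%SET by exact: imset_f.
apply/existsP; exists [ffun i => enum_rank_in (fP i) (f i)].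
apply/forallP => i; apply/forallP => j; apply/implyP => /f_proper.
rewrite !ffunE; apply: contra => /eqP /(congr1 enum_val).
by rewrite !enum_rankK_in// => ->.
Qed.

Lemma chromatic_number_coloring :
  exists f : 'I_n -> 'I_(chromatic_number G), forall i j, G i j -> f i != f j.
Proof.
rewrite /chromatic_number; case: ex_minnP => k /existsP[f f_proper] _.
by exists f => i j Gij; move: f_proper => /forallP/(_ i)/forallP/(_ j)/implyP; apply.
Qed.

Lemma chromatic_number_le_order : (chromatic_number G <= n)%N.
Proof.
apply: leq_trans (chromatic_number_le (f := id) _) _.
  by move=> i j; apply: contraTneq => ->; rewrite adj_irrefl.
by rewrite -[leqRHS](card_ord n) max_card.
Qed.

End Chromatic.

(* If the total defect [delta] is below [M], choosing for each vertex a maximal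
   entry of its row gives a proper coloring, each color of which has column
   norm at least [M - delta]; otherwise [chi <= n] suffices. *)
Lemma chromatic_weight (R : realDomainType) n (G : sgraph n)
    (A : 'I_n -> 'I_n -> R) (r c : 'I_n -> R) (M : R) :
  (forall v k, 0 <= A v k) -> (forall v k, A v k <= c k) ->
  (forall v, exists k, r v = A v k) -> (forall v, r v <= M) -> 0 <= M ->
  (chromatic_number G)%:R * M <=
  n%:R * (\sum_k edge_sum G (fun i j => Num.min (A i k) (A j k))
          + \sum_v (M - r v)) + \sum_k c k.
Proof.
move=> A0 Ac rA rM M0; set mu := \sum_k edge_sum _ _; set delta := mu + _.
have min0 k i j : 0 <= Num.min (A i k) (A j k) by rewrite le_min !A0.
have edge0 k : 0 <= edge_sum G (fun i j => Num.min (A i k) (A j k)).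
  exact: edge_sum_ge0.
have mu0 : 0 <= mu by apply: sumr_ge0.
have c0 k : (0 < n)%N -> 0 <= c k.
  by move=> n0; apply: le_trans (Ac (Ordinal n0) k).
have chi_n : (chromatic_number G)%:R <= n%:R :> R.
  by rewrite ler_nat chromatic_number_le_order.
have sum_c0 : 0 <= \sum_k c k.
  by apply: sumr_ge0 => k _; apply: c0; apply: leq_ltn_trans (ltn_ord k).
have [Md|dM] := leP M delta.
  apply: (@le_trans _ _ (n%:R * delta)); last by rewrite lerDl.
  by apply: ler_pM.
have defect v : M - r v <= \sum_v (M - r v).
  rewrite (bigD1 v)//= lerDl; apply: sumr_ge0 => w _; by rewrite subr_ge0.
have delta_r v : M - delta <= r v.
  by have := defect v; rewrite /delta; lra.
have [f fE] := choice rA.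
have f_proper i j : G i j -> f i != f j.
  move=> Gij; apply/negP => /eqP fij.
  have : Num.min (A i (f i)) (A j (f i)) <= mu.
    rewrite /mu (bigD1 (f i))//=.
    apply: le_trans (_ : edge_sum G (fun i' j' => Num.min (A i' (f i)) (A j' (f i))) <= _).
      apply: (@le_edge_sum _ _ G (fun i' j' => Num.min (A i' (f i)) (A j' (f i)))) => //.
      by move=> *; exact: minC.
    by rewrite lerDl; apply: sumr_ge0.
  (* If adjacent [i], [j] share a color, the smaller of [r i], [r j] is at most [mu]; adding its own
     defect gives [M <= delta], a contradiction. *)
  rewrite -fE fij -fE => min_mu; apply/negP: dM; rewrite -leNgt /delta.
  have := defect i; have := defect j; move: min_mu.
  by case: (leP (r i) (r j)) => _ *; lra.
have le_colors : \sum_(k in f @: 'I_n) (M - delta) <= \sum_k c k.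
  rewrite [leRHS](bigID [in (f @: 'I_n)%SET])/=.
  apply: ler_wpDr; first by apply: sumr_ge0 => k _; apply: c0; apply: leq_ltn_trans (ltn_ord k).
  apply: ler_sum => _ /imsetP[v _ ->].
  by apply: le_trans (delta_r v) _; rewrite fE.
rewrite sumr_const -mulr_natl in le_colors.
have chi_colors : (chromatic_number G)%:R <= #|f @: 'I_n|%:R :> R.
  by rewrite ler_nat chromatic_number_le.
have chiM : (chromatic_number G)%:R * (M - delta) <= #|f @: 'I_n|%:R * (M - delta).
  by rewrite ler_wpM2r// subr_ge0 ltW.
(* Split [M] as [(M - delta) + delta]: the first part is paid by the column bounds of the colors in
   use, the second by the order [n]. *)
have : (chromatic_number G)%:R * delta <= n%:R * delta.
  by rewrite ler_wpM2r// addr_ge0// sumr_ge0// => v _; rewrite subr_ge0.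
by move: chiM le_colors; rewrite mulrBr; lra.
Qed.

Lemma chromatic_ratio_max (R : realType) n (G : sgraph n) : (0 < n)%N ->
  is_max
    [set \sum_(k < n)
       (n%:R * edge_sum G (fun i j => `|x i k - x j k| + `|x i k + x j k|)
        + 2 * n%:R * mx_norm (row k x)
        - 2 * n%:R * (deg G k)%:R * l1norm (x k)
        - 2 * mx_norm (col k x))
       / (2 * mx_norm x)
    | x in [set x : 'M[R]_n | x != 0]]
    (n%:R ^+ 2 - (chromatic_number G)%:R).
Proof.
move=> n0.
have ratioE (x : 'M[R]_n) : x != 0 ->
    \sum_(k < n)
       (n%:R * edge_sum G (fun i j => `|x i k - x j k| + `|x i k + x j k|)
        + 2 * n%:R * mx_norm (row k x)
        - 2 * n%:R * (deg G k)%:R * l1norm (x k)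
        - 2 * mx_norm (col k x))
       / (2 * mx_norm x) =
    (n%:R * \sum_k mx_norm (row k x) - \sum_k mx_norm (col k x)
     - n%:R * \sum_k edge_sum G (fun i j => Num.min `|x i k| `|x j k|))
    / mx_norm x.
  move=> x0; rewrite -mulr_suml invfM mulrA; congr (_ / _).
  apply: (canLR (mulfK _)); first by rewrite pnatr_eq0.
  rewrite !sumrB big_split/= -!mulr_sumr.
  (* The degree term is given by rows, while [edge_sum_abs] produces it by columns; exchanging the
     sums lets them cancel. *)
  have -> : \sum_k 2 * n%:R * (deg G k)%:R * l1norm (x k) =
      2 * n%:R * \sum_k \sum_i (deg G i)%:R * `|x i k|.
    rewrite exchange_big mulr_sumr; apply: eq_bigr => k _.
    by rewrite -mulr_sumr mulrA.
  rewrite (eq_bigr _ (fun k _ => edge_sum_abs G (fun i => x i k))).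
  by rewrite sumrB -!mulr_sumr; ring.
apply: is_max_image => [x x0|].
  rewrite ratioE// ler_pdivrMr ?mx_norm_gt0//.
  have := @chromatic_weight R n G (fun v k => `|x v k|)
    (fun v => mx_norm (row v x)) (fun k => mx_norm (col k x)) (mx_norm x).
  rewrite sumrB sumr_const card_ord -[mx_norm x *+ n]mulr_natl => H.
  (* The row defects total [n%:R * mx_norm x] minus the row norms, which turns the bound of
     [chromatic_weight] into the goal. *)
  suff : (chromatic_number G)%:R * mx_norm x <=
    n%:R * (\sum_k edge_sum G (fun i j => Num.min `|x i k| `|x j k|)
            + (n%:R * mx_norm x - \sum_v mx_norm (row v x)))
    + \sum_k mx_norm (col k x) by lra.
  apply: H => // [v k|v|v|]; last exact: mx_norm_ge0.
  - by have := le_mx_norm (col k x) v ord0; rewrite mxE.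
  - have [//|//|i [k ->]] := mx_norm_attained (row v x).
    by exists k; rewrite mxE.
  - by apply: mx_norm_le => [|i k]; rewrite ?mx_norm_ge0// mxE le_mx_norm.
have [f f_proper] := chromatic_number_coloring G.
have chi_n := chromatic_number_le_order G.
(* The 0-1 matrix of an optimal coloring: every row has norm 1, the columns past the chromatic
   number are zero, and properness kills all edge minima. *)
pose x : 'M[R]_n := \matrix_(v, k) (widen_ord chi_n (f v) == k)%:R.
have xE v k : `|x v k| = (widen_ord chi_n (f v) == k)%:R by rewrite mxE normr_nat.
have x_neq0 : x != 0.
  pose v0 := Ordinal n0.
  apply/eqP => /(congr1 (fun y : 'M_n => y v0 (widen_ord chi_n (f v0))))/eqP.
  by rewrite !mxE eqxx oner_eq0.
exists x => //; rewrite ratioE//.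
have x1 : mx_norm x = 1.
  apply/eqP; rewrite eq_le mx_norm_le//=; last first.
    by move=> v k; rewrite xE lern1 leq_b1.
  have := le_mx_norm x (Ordinal n0) (widen_ord chi_n (f (Ordinal n0))).
  by rewrite xE eqxx.
have row_ge : n%:R <= \sum_v mx_norm (row v x).
  rewrite -[X in X%:R](card_ord n) -sumr_const; apply: ler_sum => v _.
  have := le_mx_norm (row v x) ord0 (widen_ord chi_n (f v)).
  by rewrite mxE xE eqxx.
have col_le : \sum_k mx_norm (col k x) <= (chromatic_number G)%:R.
  rewrite -[in leRHS](card_ord (chromatic_number G)) -sumr_const (big_ord_widen _ (fun=> 1) chi_n).
  rewrite [leRHS]big_mkcond/=; apply: ler_sum => k _.
  apply: mx_norm_le => [|v j]; first by case: ifP.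
  rewrite mxE xE; case: eqP => [<-/=|_]; last by case: ifP.
  by rewrite ltn_ord.
rewrite x1 divr1 [X in _ - n%:R * X]big1 => [|k _].
  rewrite mulr0 subr0 expr2; apply: lerB => //.
  by rewrite ler_wpM2l.
apply: edge_sum_adj0 => i j /f_proper fij; rewrite !xE.
case: eqP => [<-|_]; last by rewrite min_l.
rewrite min_r//; case: eqP => // /(congr1 val)/= /val_inj fji.
by rewrite fji eqxx in fij.
Qed.

(** * The Motzkin-Straus inequality in homogeneous, division-free form *)

(** Cauchy-Schwarz against the constant 1, from expanding the sum of all [(a x - a y) ^+ 2]. *)
Lemma sum_sqr_le (R : realDomainType) (T : finType) (C : {set T}) (a : T -> R) :
  (\sum_(x in C) a x) ^+ 2 <= #|C|%:R * \sum_(x in C) a x ^+ 2.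
Proof.
set s := \sum_(x in C) a x; set q := \sum_(x in C) a x ^+ 2.
have inner x : \sum_(y in C) (a x - a y) ^+ 2 =
    #|C|%:R * a x ^+ 2 - 2 * s * a x + q.
  transitivity (\sum_(y in C) (a x ^+ 2 - 2 * a x * a y + a y ^+ 2)).
    by apply: eq_bigr => y _; ring.
  rewrite big_split sumrB/= sumr_const -mulr_sumr -/s -/q -[_ *+ #|C|]mulr_natl.
  by ring.
have : 0 <= \sum_(x in C) \sum_(y in C) (a x - a y) ^+ 2.
  by apply: sumr_ge0 => x _; apply: sumr_ge0 => y _; exact: sqr_ge0.
under eq_bigr => x _ do rewrite inner.
rewrite big_split sumrB/= sumr_const -!mulr_sumr -/s -/q -[q *+ #|C|]mulr_natl.
by rewrite expr2; lra.
Qed.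

Section MotzkinStraus.
Variables (R : realDomainType) (T : finType) (D : rel T) (w : nat).
Hypotheses (D_sym : symmetric D) (D_irrefl : irreflexive D).
Hypothesis clique_le : forall C : {set T},
  {in C &, forall x y, x != y -> D x y} -> (#|C| <= w)%N.

(** As [D] is irreflexive, [N] is the identity plus the adjacency matrix of the complement graph;
    [Q] is its quadratic form and [L] half the gradient of [Q]. *)
Let N x y : R := (~~ D x y)%:R.
Let L (a : T -> R) x := \sum_y N x y * a y.
Let Q a := \sum_x a x * L a x.

Lemma sum_delta2 (F : T -> R) u v :
  \sum_x F x * ((x == u)%:R - (x == v)%:R) = F u - F v.
Proof.
have delta z : \sum_x F x * (x == z)%:R = F z.
  rewrite (bigD1 z)//= eqxx mulr1 big1 ?addr0// => x /negbTE ->.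
  by rewrite mulr0.
under eq_bigr do rewrite mulrBr.
by rewrite sumrB !delta.
Qed.

(** The coefficient of [t ^+ 2] is [N u u - N u v - N v u + N v v], which is [1 - 1 - 1 + 1 = 0]. *)
Lemma nonadjacent_form_shift a u v t : u != v -> ~~ D u v ->
  Q (fun x => a x + t * ((x == u)%:R - (x == v)%:R)) =
  Q a + 2 * t * (L a u - L a v).
Proof.
move=> uv Duv; pose d x : R := (x == u)%:R - (x == v)%:R.
have N_sym x y : N x y = N y x by rewrite /N D_sym.
have Ld x : L (fun x => a x + t * d x) x = L a x + t * (N x u - N x v).
  rewrite /L -(sum_delta2 (N x)) mulr_sumr -big_split/=.
  by apply: eq_bigr => y _; rewrite mulrDr mulrCA.
have sumN z : \sum_x a x * N x z = L a z.
  by apply: eq_bigr => x _; rewrite mulrC N_sym.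
transitivity (\sum_x (a x * L a x + t * (a x * N x u) - t * (a x * N x v)
   + t * (L a x * d x) + t ^+ 2 * ((N x u - N x v) * d x))).
  by apply: eq_bigr => x _; rewrite Ld -/(d x); ring.
rewrite !(big_split, sumrN)/= -!mulr_sumr !sumN !sum_delta2.
by rewrite /N !D_irrefl (D_sym v u) (negbTE Duv) /Q /=; ring.
Qed.

(* Shifting weight between two nonadjacent vertices changes the form linearly,
   so the support can be shrunk, without increasing the form, to a clique. *)
Lemma motzkin_straus (a : T -> R) : (forall x, 0 <= a x) ->
  (\sum_x a x) ^+ 2 <= w%:R * \sum_x \sum_(y | ~~ D x y) a x * a y.
Proof.
have QE b : \sum_x \sum_(y | ~~ D x y) b x * b y = Q b.
  apply: eq_bigr => x _; rewrite mulr_sumr big_mkcond/=; apply: eq_bigr => y _.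
  by rewrite /N; case: D; rewrite ?mul0r ?mul1r ?mulr0.
rewrite QE; pose supp (b : T -> R) := [set x | b x != 0]%SET.
have [k] := ubnP #|supp a|; elim: k a => // k IH a; rewrite ltnS => supp_k a0.
have [/existsP[u /existsP[v]]|] := boolP [exists u, exists v,
  [&& u \in supp a, v \in supp a, u != v & ~~ D u v]].
  wlog le_uv : u v / L a u <= L a v.
    move=> H /and4P[ua va uv Duv]; have /orP[le|le] := le_total (L a u) (L a v).
      by apply: (H u v) => //; rewrite ua va uv.
    by apply: (H v u) => //; rewrite ua va eq_sym uv D_sym.
  rewrite !inE => /and4P[ua va uv Duv].
  (* All the weight of [v] moves to [u]: the total is kept, [v] leaves the support, and [Q] does not
     grow because [L a u <= L a v]. *)
  pose b x := a x + a v * ((x == u)%:R - (x == v)%:R).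
  have bu : b u = a u + a v by rewrite /b eqxx (negbTE uv) subr0 mulr1.
  have bv : b v = 0 by rewrite /b eqxx eq_sym (negbTE uv) sub0r mulrN1 subrr.
  have bE x : x != u -> x != v -> b x = a x.
    by move=> /negbTE xu /negbTE xv; rewrite /b xu xv subrr mulr0 addr0.
  have b0 x : 0 <= b x.
    have [->|xu] := eqVneq x u; first by rewrite bu addr_ge0.
    by have [->|xv] := eqVneq x v; rewrite ?bv// bE.
  have sum_b : \sum_x b x = \sum_x a x.
    by rewrite big_split/= (sum_delta2 (fun=> a v)) subrr addr0.
  have supp_b : (#|supp b| < k)%N.
    apply: leq_trans supp_k; apply: proper_card; apply/properP; split.
      apply/fintype.subsetP => x; rewrite !inE; have [->//|xu] := eqVneq x u.
      by have [->//|xv] := eqVneq x v; rewrite bE.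
    by exists v; rewrite !inE ?bv ?eqxx.
  rewrite -sum_b; apply: le_trans (IH b supp_b b0) _.
  rewrite ler_wpM2l// /b nonadjacent_form_shift// gerDl.
  by rewrite mulr_ge0_le0 ?mulr_ge0// subr_le0.
(* The support is now a clique, so only the diagonal of [Q] survives and [sum_sqr_le] concludes. *)
rewrite negb_exists => /forallP clq.
have suppD : {in supp a &, forall x y, x != y -> D x y}.
  move=> x y xa ya xy; move: (clq x); rewrite negb_exists => /forallP/(_ y).
  by rewrite xa ya xy negbK.
have -> : Q a = \sum_(x in supp a) a x ^+ 2.
  rewrite [RHS]big_mkcond/=; apply: eq_bigr => x _; rewrite inE.
  case: eqVneq => [->|ax]; first by rewrite mul0r.
  rewrite /L (bigD1 x)//= big1 => [|y yx].
    by rewrite /N D_irrefl mul1r addr0 expr2.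
  have [->|ay] := eqVneq (a y) 0; first by rewrite mulr0.
  by rewrite /N suppD ?mul0r ?inE// eq_sym.
have -> : \sum_x a x = \sum_(x in supp a) a x.
  by rewrite [RHS]big_mkcond/=; apply: eq_bigr => x _; rewrite inE; case: eqVneq.
apply: le_trans (sum_sqr_le _ _) _; rewrite ler_wpM2r ?ler_nat ?clique_le//.
by apply: sumr_ge0 => x _; exact: sqr_ge0.
Qed.

End MotzkinStraus.

(** * Matchings as cliques of the disjointness graph on edges *)

Section Matching.
Variables (R : realDomainType) (n : nat) (G : sgraph n).
Let D (e e' : edge G) := [disjoint val e & val e']%bool.

Lemma disjoint_edge_sym : symmetric D.
Proof. by move=> e e'; rewrite /D disjoint_sym. Qed.

(** An edge is nonempty, hence meets itself. *)
Lemma disjoint_edge_irrefl : irreflexive D.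
Proof.
move=> e; have /imsetP[[i j] _ eE] := valP e.
apply/negbTE/negP => /pred0P/(_ i); rewrite /= andbb.
by rewrite (_ : sval e = [set i; j]%SET) ?set21.
Qed.

Lemma disjoint_edges_sum_double (F : edge G -> edge G -> R) :
  (forall e e', F e e' = F e' e) ->
  2 * disjoint_edges_sum F = \sum_e \sum_(e' | D e e') F e e'.
Proof.
move=> Fsym.
rewrite -(sum_orient (lt := fun e e' => (enum_rank e < enum_rank e')%N) _
  disjoint_edge_sym).
  rewrite /disjoint_edges_sum mulr_sumr; apply: eq_bigr => e _.
  rewrite mulr_sumr; apply: eq_bigr => e' _.
  by rewrite [F e' e]Fsym mulr_natl mulr2n.
move=> e e' De; case: ltngtP => // /val_inj/enum_rank_inj ee'.
by rewrite ee' disjoint_edge_irrefl in De.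
Qed.

Lemma clique_matching (C : {set edge G}) :
  {in C &, forall e e', e != e' -> D e e'} -> (#|C| <= matching_number G)%N.
Proof.
move=> CD; rewrite -(card_imset _ (@val_inj _ _ (edge G))).
apply: (@leq_bigmax_cond _ (matching G) (fun M => #|M|)).
apply/andP; split; first by apply/fintype.subsetP => _ /imsetP[e _ ->]; exact: valP.
apply/finset.trivIsetP => _ _ /imsetP[e eC ->] /imsetP[e' e'C ->] ee'.
by apply: CD => //; apply: contraNneq ee' => ->.
Qed.

Lemma maximum_matching_clique : exists2 C : {set edge G},
  {in C &, forall e e', e != e' -> D e e'} & #|C| = matching_number G.
Proof.
have [|M /andP[Msub Mtriv] Mmax] := @eq_bigmax_cond _ [in matching G] (fun M => #|M|).
  apply/card_gt0P; exists finset.set0; apply/andP; split; first exact: finset.sub0set.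
  by apply/finset.trivIsetP => A B; rewrite inE.
exists [set e | val e \in M]%SET.
  move=> e e'; rewrite !inE => eM e'M ee'.
  by apply: (finset.trivIsetP Mtriv) => //; apply: contraNneq ee' => /val_inj ->.
rewrite /matching_number Mmax -(card_imset _ (@val_inj _ _ (edge G))).
apply: eq_card => A; apply/imsetP/idP => [[e]|AM]; first by rewrite inE => eM ->.
by exists (exist _ A (fintype.subsetP Msub A AM)); rewrite ?inE.
Qed.

Lemma matching_number_gt0 : edges G != finset.set0 -> (0 < matching_number G)%N.
Proof.
move=> /set0Pn[A AG].
rewrite -(cards1 (exist (fun e => e \in edges G) A AG : edge G)).
by apply: clique_matching => e e' /set1P -> /set1P ->; rewrite eqxx.
Qed.

(** The square expands over ordered pairs of edges, and the doubled sum removes the disjoint ones;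
    what is left is the Motzkin-Straus form. *)
Lemma sqr_l1norm_sub_disjoint (a : edge G -> R) : (forall e, 0 <= a e) ->
  l1norm a ^+ 2 - 2 * disjoint_edges_sum (fun e e' => a e * a e') =
  \sum_e \sum_(e' | ~~ D e e') a e * a e'.
Proof.
move=> a0; rewrite disjoint_edges_sum_double => [|*]; last exact: mulrC.
have -> : l1norm a = \sum_e a e.
  by apply: eq_bigr => e _; rewrite ger0_norm.
apply: (canLR (addrK _)); rewrite -big_split/= expr2 mulr_suml.
by apply: eq_bigr => e _; rewrite mulr_sumr (bigID (D e))/= addrC.
Qed.

End Matching.

Lemma matching_ratio_max (R : realType) n (G : sgraph n) :
  edges G != finset.set0 ->
  is_max
    [set l1norm y ^+ 2
         / (l1norm y ^+ 2 - 2 * disjoint_edges_sum (fun e e' => y e * y e'))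
    | y in [set y : {ffun edge G -> R} | y != 0]]
    (matching_number G)%:R.
Proof.
move=> /matching_number_gt0 m_gt0; apply: is_max_image => [y y_neq0|].
  have abs_ge0 e : 0 <= `|y e| by [].
  have l1_abs : l1norm (fun e => `|y e|) = l1norm y.
    by apply: eq_bigr => e _; rewrite normr_id.
  have l1_gt0 : 0 < l1norm y.
    rewrite lt0r sumr_ge0// andbT; apply: contra y_neq0 => /eqP/psumr_eq0P y0.
    by apply/eqP/ffunP => e; rewrite ffunE; apply/normr0_eq0/y0.
  have := motzkin_straus (@disjoint_edge_sym n G) (@disjoint_edge_irrefl n G)
    (@clique_matching n G) abs_ge0.
  rewrite -sqr_l1norm_sub_disjoint// l1_abs -[\sum_x _]/(l1norm y).
  set den := _ - _; set den' := _ - _ => le_den.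
  (* Passing from [y] to its absolute value keeps the numerator and can only shrink the
     denominator. *)
  have le_den' : den <= den'.
    rewrite lerD2l lerN2 ler_wpM2l//; apply: ler_sum => e _; apply: ler_sum => e' _.
    by rewrite -normrM ler_norm.
  (* A nonpositive denominator would force the positive [l1norm y ^+ 2] to be at most 0. *)
  have den_gt0 : 0 < den.
    rewrite ltNge; apply/negP => den_le0.
    have : l1norm y ^+ 2 <= 0 by apply: le_trans le_den _; rewrite mulr_ge0_le0.
    by rewrite leNgt exprn_gt0.
  rewrite ler_pdivrMr ?(lt_le_trans den_gt0)//; apply: le_trans le_den _.
  by rewrite ler_wpM2l.
have [C CD mE] := maximum_matching_clique G.
pose y : {ffun edge G -> R} := [ffun e => (e \in C)%:R].
have yE e : y e = (e \in C)%:R by rewrite ffunE.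
have y_ge0 e : 0 <= y e by rewrite yE.
have sum_y : \sum_e y e = #|C|%:R.
  rewrite -sum1_card natr_sum [RHS]big_mkcond/=; apply: eq_bigr => e _.
  by rewrite yE; case: ifP.
have l1_y : l1norm y = #|C|%:R.
  by rewrite -sum_y /l1norm; apply: eq_bigr => e _; rewrite ger0_norm.
exists y.
  apply: contraTneq m_gt0 => y0; rewrite -mE -(ltr_nat R) -sum_y y0.
  by rewrite big1 ?ltxx// => e _; rewrite ffunE.
(* For the indicator of a maximum matching only the diagonal pairs remain, so the ratio is the
   square of [#|C|] over [#|C|]. *)
rewrite sqr_l1norm_sub_disjoint// (_ : \sum_e _ = #|C|%:R).
  by rewrite l1_y mE expr2 mulfK// pnatr_eq0 -lt0n.
rewrite -sum_y; apply: eq_bigr => e _; rewrite yE; case: (boolP (e \in C)) => [eC|_]; last first.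
  by rewrite big1// => e' _; rewrite mul0r.
rewrite (bigD1 e)/=; last exact: (negbT (disjoint_edge_irrefl e)).
rewrite yE eC mul1r big1 ?addr0// => e' /andP[De e'e]; rewrite yE.
case: (boolP (e' \in C)) => [e'C|]; last by rewrite mulr0.
by rewrite CD// eq_sym in De.
Qed.

(* [mx_norm] is the entrywise sup norm. *)
Theorem theoremC (R : realType) (n : nat) (G : sgraph n) (n_gt0 : (0 < n)%N) :
  [/\ is_max
        [set (edge_sum G (fun i j => `|x ord0 i - x ord0 j| + `|x ord0 i + x ord0 j|)
              - 2 * \sum_(i < n) ((deg G i)%:R - 1) * `|x ord0 i|)
             / (2 * mx_norm x)
        | x in [set x : 'rV[R]_n | x != 0]]
        (independence_number G)%:R,
      exists2 m : R,
        is_max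
          [set \sum_(k < n)
             (n%:R * edge_sum G (fun i j => `|x i k - x j k| + `|x i k + x j k|)
              + 2 * n%:R * mx_norm (row k x)
              - 2 * n%:R * (deg G k)%:R * l1norm (x k)
              - 2 * mx_norm (col k x))
             / (2 * mx_norm x)
          | x in [set x : 'M[R]_n | x != 0]]
          m
        & (chromatic_number G)%:R = n%:R ^+ 2 - m
    & edges G != finset.set0 ->
      is_max
        [set l1norm y ^+ 2
             / (l1norm y ^+ 2 - 2 * disjoint_edges_sum (fun e e' => y e * y e'))
        | y in [set y : {ffun edge G -> R} | y != 0]]
        (matching_number G)%:R].
Proof.
split; first exact: independence_ratio_max.
  exists (n%:R ^+ 2 - (chromatic_number G)%:R); first exact: chromatic_ratio_max.
  by rewrite subKr.
exact: matching_ratio_max.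
Qed.
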